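(* Let $\kappa>0$ and $\lambda\in[0,1)$, and let $\psi\in L^2(\mathbb{R},\mathrm{d}\mu)$, where $\mathrm{d}\mu(\omega)=\frac{\mathrm{d}\omega}{1+\kappa\omega^2}$. Define the continuous time representation of $\psi$ by $$\psi^{c}(\tau)=\sqrt{\frac{2\sqrt{\kappa}}{\pi}}\int_{-\infty}^{+\infty}\frac{\mathrm{d}\omega}{(1+\kappa\omega^2)^{3/2}}\exp\left(i\tau\frac{\arctan(\sqrt{\kappa}\,\omega)}{\sqrt{\kappa}}\right)\psi(\omega),\qquad \tau\in\mathbb{R},$$ and the discrete time representation of $\psi$ by $$\psi_n=\sqrt{\frac{2\sqrt{\kappa}}{\pi}}\int_{-\infty}^{+\infty}\frac{\mathrm{d}\omega}{(1+\kappa\omega^2)^{3/2}}\,e^{2i(\lambda+n)\arctan(\sqrt{\kappa}\,\omega)}\,\psi(\omega),\qquad n\in\mathbb{Z}.$$ Then the two representations determine each other: for every $n\in\mathbb{Z}$, $$\psi_n=\psi^{c}\bigl(2\sqrt{\kappa}(\lambda+n)\bigr),$$ and for every $\tau\in\mathbb{R}$, $$\psi^{c}(\tau)=\sum_{n=-\infty}^{\infty}\psi_n\,\operatorname{sinc}\left(\frac{\tau-2\sqrt{\kappa}(\lambda+n)}{2\sqrt{\kappa}}\right).$$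
   Context: Here $\operatorname{sinc}x=\frac{\sin(\pi x)}{\pi x}$ for $x\neq0$ and $\operatorname{sinc}0=1$. A bi-infinite sum $\sum_{n=-\infty}^{\infty}$ is understood as $\lim_{N\to\infty}\sum_{n=-N}^{N}$. The space $L^2(\mathbb{R},\mathrm{d}\mu)$ consists of (classes of) complex-valued measurable functions on $\mathbb{R}$ that are square integrable with respect to $\mu$. *)

(* Defs.v *)
From HB Require Import structures.
From mathcomp Require Export all_boot all_order all_algebra.
From mathcomp Require Export all_classical all_reals all_analysis measurable_realfun.
From mathcomp.real_closed Require Export complex.

Set Implicit Arguments.
Unset Strict Implicit.
Unset Printing Implicit Defensive.

Export Order.TTheory GRing.Theory Num.Theory.
Export numFieldNormedType.Exports.

Local Open Scope classical_set_scope.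
Local Open Scope ring_scope.
Local Open Scope complex_scope.

(* e^{it}; the library has no complex exponential. *)
Definition expi {R : realType} (t : R) : R[i] := cos t +i* sin t.

Definition sinc {R : realType} (x : R) : R :=
  if x == 0 then 1 else sin (pi * x) / (pi * x).

(* Lebesgue integral of a complex-valued function, componentwise: it is the
   usual one when f is integrable, the only case in which it is meaningful. *)
Definition Cintegral d (T : measurableType d) (R : realType)
    (mu : {measure set T -> \bar R}) (f : T -> R[i]) : R[i] :=
  (\int[mu]_x complex.Re (f x)) +i* (\int[mu]_x complex.Im (f x)).

(* Functions rather than classes. On the real line measurable means Borel, which
   loses nothing: every Lebesgue class has a Borel representative. *)
Definition L2 d (T : measurableType d) (R : realType)
    (mu : {measure set T -> \bar R}) : set (T -> R[i]) :=
  [set f : T -> R[i] | [/\ measurable_fun setT (fun x => complex.Re (f x)),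
               measurable_fun setT (fun x => complex.Im (f x)) &
               mu.-integrable setT (fun x => ((Normc.normc (f x)) ^+ 2)%:E)]].

(* The positivity of kappa is an argument because without it the density can
   take negative values, and the set function need not be a measure. *)
Definition mu_ {R : realType} (kappa : R) (kappa_gt0 : 0 < kappa) :
    set (measurableTypeR R) -> \bar R :=
  fun A => (\int[lebesgue_measure]_(w in A) ((1 + kappa * w ^+ 2)^-1)%:E)%E.

Section mu_measure.
Context {R : realType} (kappa : R) (kappa_gt0 : 0 < kappa).
Local Notation mu := (mu_ kappa_gt0).

Let density_ge0 (w : R) : 0 <= (1 + kappa * w ^+ 2)^-1.
Proof. by rewrite invr_ge0 addr_ge0// mulr_ge0 ?sqr_ge0 ?ltW. Qed.

Let mu0 : mu set0 = 0%E.
Proof. by rewrite /mu_ integral_set0. Qed.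

Let mu_ge0 A : (0 <= mu A)%E.
Proof. by apply: integral_ge0 => w _; rewrite lee_fin. Qed.

Let mu_sigma_additive : semi_sigma_additive mu.
Proof.
apply: semi_sigma_additive_nng_induced => [|w]; last by rewrite lee_fin.
apply/measurable_EFinP; apply: continuous_measurable_fun => w.
apply: cvgV; first by rewrite gt_eqF// ltr_pwDl// mulr_ge0 ?sqr_ge0 ?ltW.
apply: cvgD; first exact: cvg_cst.
by apply: cvgM; [exact: cvg_cst|exact: exprn_continuous].
Qed.

HB.instance Definition _ := isMeasure.Build _ _ _ mu mu0 mu_ge0 mu_sigma_additive.

End mu_measure.

Definition psic {R : realType} (kappa : R) (psi : R -> R[i]) (tau : R) : R[i] :=
  (Num.sqrt (2 * Num.sqrt kappa / pi))%:C *
  Cintegral lebesgue_measure (fun w : R =>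
    (((1 + kappa * w ^+ 2) `^ (3 / 2))^-1)%:C *
    expi (tau * (atan (Num.sqrt kappa * w) / Num.sqrt kappa)) * psi w).

Definition psid {R : realType} (kappa lambda : R) (psi : R -> R[i]) (n : int)
    : R[i] :=
  (Num.sqrt (2 * Num.sqrt kappa / pi))%:C *
  Cintegral lebesgue_measure (fun w : R =>
    (((1 + kappa * w ^+ 2) `^ (3 / 2))^-1)%:C *
    expi (2 * (lambda + n%:~R) * atan (Num.sqrt kappa * w)) * psi w).

(* The partial sum over -N <= n <= N of a bi-infinite series. *)
Definition symsum {V : zmodType} (u : int -> V) (N : nat) : V :=
  \sum_(k < N.*2.+1) u (k%:Z - N%:Z).

(* Main.v *)
From HB Require Import structures.
Require Import Defs.
From mathcomp Require Import ring lra zify.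

Set Implicit Arguments.
Unset Strict Implicit.
Unset Printing Implicit Defensive.

Local Open Scope classical_set_scope.
Local Open Scope ring_scope.
Local Open Scope complex_scope.

(* With th = atan (sqrt kappa * w) and t = tau / (2 sqrt kappa) - lambda, the
   expansion is the Fourier series of th |-> exp (2 i t th) on ]-pi/2, pi/2[,
   integrated against psi; the weight (1 + kappa w^2)^(-3/2) equals
   cos th / (1 + kappa w^2), and the factor cos th tames the endpoints.
   The th-derivative of the partial sum of sinc (t - n) exp (- 2 i (t - n) th)
   is a Dirichlet kernel (-1)^N cos ((2N + 1) th) / cos th times a smooth
   factor. Integrating it by parts once shows that the partial sum differs from
   its value c_N at th = 0 by O(1 / (N cos th)), uniformly in th. Hence
   cos th times the N-th Fourier sum tends uniformly to
   (lim c_N) cos th exp (2 i t th), and lim c_N = 1 follows by comparing one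
   pair of Fourier coefficients on both sides. *)

(** * Symmetric partial sums *)

Lemma symsum0 (V : zmodType) (u : int -> V) : symsum u 0 = u 0.
Proof. by rewrite /symsum big_ord1. Qed.

Lemma symsumS (V : zmodType) (u : int -> V) (N : nat) :
  symsum u N.+1 = symsum u N + (u N.+1%:Z + u (- N.+1%:Z)).
Proof.
rewrite /symsum doubleS big_ord_recr big_ord_recl/= sub0r addrC addrA.
rewrite [LHS](_ : _ = u N.+1%:Z + u (- N.+1%:Z) +
    \sum_(k < N.*2.+1) u (k%:Z - N%:Z)); first by rewrite addrC.
congr (_ + _ + _); first by congr u; lia.
by apply: eq_bigr => i _; congr u; rewrite /bump/=; lia.
Qed.

Lemma eq_symsum (V : zmodType) (u v : int -> V) (N : nat) :
  u =1 v -> symsum u N = symsum v N.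
Proof. by move=> uv; apply: eq_bigr. Qed.

Lemma symsum_raddf (V W : zmodType) (f : {additive V -> W}) (u : int -> V) N :
  f (symsum u N) = symsum (f \o u) N.
Proof. exact: raddf_sum. Qed.

Lemma mulr_symsuml (R : pzRingType) (c : R) (u : int -> R) N :
  symsum u N * c = symsum (fun n => u n * c) N.
Proof. exact: mulr_suml. Qed.

Lemma mulr_symsumr (R : pzRingType) (c : R) (u : int -> R) N :
  c * symsum u N = symsum (fun n => c * u n) N.
Proof. exact: mulr_sumr. Qed.

Lemma symsumD (V : zmodType) (u v : int -> V) N :
  symsum (fun n => u n + v n) N = symsum u N + symsum v N.
Proof. exact: big_split. Qed.

Lemma symsum_delta (R : pzRingType) (u : int -> R) (m : int) N :
  (`|m| <= N)%N -> symsum (fun n => u n * (n == m)%:R) N = u m.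
Proof.
move=> mN.
have mlt : (absz (m + N%:Z)%R < N.*2.+1)%N by lia.
rewrite /symsum (bigD1 (Ordinal mlt))//= big1 => [|i im].
  rewrite addr0 (_ : (absz _)%:Z - N%:Z = m); last by lia.
  by rewrite eqxx mulr1.
case: eqP => [e|]; rewrite ?mulr0//.
by exfalso; move/eqP: im; apply; apply/val_inj => /=; lia.
Qed.

(** * The Dirichlet kernel *)

Section trig.
Context {R : realType}.
Implicit Types (x a b t th beta : R) (n m : int).

Definition altsign n : R := (-1) ^+ `|n|%N.

Lemma altsignN n : altsign (- n) = altsign n.
Proof. by rewrite /altsign abszN. Qed.

Lemma sinBpi_int x n : sin (x - pi * n%:~R) = altsign n * sin x.
Proof.
have nat_case (k : nat) (y : R) : sin (y + pi * k%:R) = (-1) ^+ k * sin y.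
  elim: k y => [|k IH] y; first by rewrite mulr0 addr0 mul1r.
  rewrite -natr1 mulrDr mulr1 addrA sinDpi IH exprS.
  by rewrite mulN1r mulNr.
case: (ltP n 0) => n0.
  have -> : n = - `|n|%N%:Z by lia.
  rewrite altsignN -nat_case mulrNz mulrN opprK.
  by rewrite /altsign absz_nat pmulrn.
have -> : n = `|n|%N%:Z by lia.
(* At the shifted point [nat_case] puts the sign on the other side; the square of the sign being 1
   brings it back. *)
have := nat_case `|n|%N (x - pi * (`|n|%N%:R)).
rewrite subrK => ->; rewrite /altsign absz_nat mulrA -exprD addnn -mul2n exprM.
by rewrite sqrrN expr1n expr1n mul1r -pmulrn.
Qed.

(** This product form also covers x = 0, which spares later computations the case distinction in
    [sinc]. *)
Lemma sincE x : pi * x * sinc x = sin (pi * x).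
Proof.
rewrite /sinc; case: eqVneq => [->|x0]; first by rewrite !(mulr0, mul0r) sin0.
by rewrite mulrCA mulfV ?mulr1// mulf_neq0// gt_eqF ?pi_gt0.
Qed.

Lemma sinc_int n m : sinc (n%:~R - m%:~R : R) = (m == n)%:R.
Proof.
rewrite -intrB; have [->|mn] := eqVneq m n; first by rewrite subrr /sinc eqxx.
rewrite /sinc intr_eq0 subr_eq0 eq_sym (negbTE mn).
have -> : (pi : R) * (n - m)%:~R = 0 - pi * (m - n)%:~R.
  by rewrite sub0r -mulrN -intrN opprB.
by rewrite sinBpi_int sin0 mulr0 mul0r.
Qed.

(* The Dirichlet kernel at distance [pi / 2] from its peak. *)
Lemma symsum_altsign_sin a th N :
  cos th * symsum (fun n => altsign n * sin (a - 2 * n%:~R * th)) N =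
  (-1) ^+ N * (sin a * cos (N.*2.+1%:R * th)).
Proof.
elim: N => [|N IH].
  by rewrite symsum0 mulr0 mul0r subr0 /altsign expr0 !mul1r mulrC.
rewrite symsumS mulrDr IH altsignN /altsign absz_nat exprS.
have -> : sin (a - 2 * (N.+1%:Z)%:~R * th) =
    sin (a - N.+1.*2%:R * th).
  by rewrite -pmulrn -mul2n natrM.
have -> : sin (a - 2 * (- N.+1%:Z)%:~R * th) =
    sin (a + N.+1.*2%:R * th).
  by rewrite mulrNz -pmulrn -mul2n natrM mulrN mulNr opprK.
have -> : N.*2.+1%:R = N.+1.*2%:R - 1 :> R.
  by rewrite doubleS -[in RHS]natr1 addrK.
have -> : N.+1.*2.+1%:R = N.+1.*2%:R + 1 :> R by rewrite natr1.
(* With [M] = 2N + 2, the two new sines add up to 2 sin a cos (M th), and 2 cos th cos (M th) = cos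
   ((M - 1) th) + cos ((M + 1) th) makes the sum telescope. *)
move: (N.+1.*2%:R) => M; rewrite mulrBl mulrDl !mul1r cosB cosD sinB sinD.
by ring.
Qed.

End trig.

(** * Derivatives of real functions *)

Section derivatives.
Context {R : realType}.
Implicit Types (f g df dg : R -> R) (a b c x : R).

Lemma is_derive1D f g x a b : is_derive x 1 f a -> is_derive x 1 g b ->
  is_derive x 1 (fun y => f y + g y) (a + b).
Proof. exact: is_deriveD. Qed.

Lemma is_derive1M f g x a b : is_derive x 1 f a -> is_derive x 1 g b ->
  is_derive x 1 (fun y => f y * g y) (f x * b + g x * a).
Proof. exact: is_deriveM. Qed.

Lemma is_derive1Ml c f x a : is_derive x 1 f a ->
  is_derive x 1 (fun y => c * f y) (c * a).
Proof. exact: is_deriveZ. Qed.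

Lemma is_derive1_affine c b x : is_derive x 1 (fun y : R => c * y + b) c.
Proof.
have := is_derive1D (is_derive1Ml c (is_derive_id x 1)) (is_derive_cst b x 1).
by rewrite mulr1 addr0.
Qed.

Lemma is_derive1_sin_affine c b x :
  is_derive x 1 (fun y => sin (c * y + b)) (c * cos (c * x + b)).
Proof.
have := @is_derive1_comp R sin (fun y => c * y + b) x _ _
  (is_derive_sin (c * x + b)) (is_derive1_affine c b x).
by rewrite mulrC.
Qed.

Lemma is_derive1_cos_affine c b x :
  is_derive x 1 (fun y => cos (c * y + b)) (- c * sin (c * x + b)).
Proof.
have := @is_derive1_comp R cos (fun y => c * y + b) x _ _
  (is_derive_cos (c * x + b)) (is_derive1_affine c b x).
by rewrite mulrC mulrN mulNr.
Qed.

Lemma is_derive1_symsum (F : int -> R -> R) (dF : int -> R) x N :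
  (forall n, is_derive x 1 (F n) (dF n)) ->
  is_derive x 1 (fun y => symsum (F^~ y) N) (symsum dF N).
Proof.
move=> dFE; elim: N => [|N IH].
  by rewrite symsum0; under eq_fun do rewrite symsum0.
rewrite symsumS; under eq_fun do rewrite symsumS.
by apply: is_derive1D => //; apply: is_derive1D.
Qed.

(** The mean value theorem applies to g + f and g - f, whose derivatives are nonnegative inside the
    interval. *)
Lemma le_dist_is_derive f g df dg a b : a <= b ->
  (forall x, a <= x <= b -> is_derive x 1 f (df x)) ->
  (forall x, a <= x <= b -> is_derive x 1 g (dg x)) ->
  (forall x, a < x < b -> `|df x| <= dg x) ->
  `|f b - f a| <= g b - g a.
Proof.
move=> + f' g' le_dfg; rewrite le_eqVlt => /predU1P[->|ab].
  by rewrite !subrr normr0.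
suff mono s : s = 1 \/ s = -1 -> 0 <= (g b + s * f b) - (g a + s * f a).
  rewrite ler_norml.
  by have := mono 1 (or_introl erefl); have := mono (-1) (or_intror erefl); lra.
move=> s1.
have h' x : a <= x <= b ->
    is_derive x 1 (fun y => g y + s * f y) (dg x + s * df x).
  by move=> xab; apply: is_derive1D (g' _ xab) (is_derive1Ml s (f' _ xab)).
have [x|x|c] := @MVT R (fun y => g y + s * f y)
  (fun x => dg x + s * df x) a b ab.
- by rewrite in_itv/= => /andP[? ?]; apply: h'; rewrite !ltW.
- apply: derivable_within_continuous => y; rewrite in_itv/= => yab.
  by have [] := h' _ yab.
rewrite in_itv/= => /le_dfg + ->; rewrite ler_norml => /andP[].
have := ab; rewrite -subr_gt0 => ba0 l u.
by apply: mulr_ge0; [case: s1 => ->; lra|exact: ltW].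
Qed.

End derivatives.

Lemma ler_normM (R : numDomainType) (x y x' y' : R) :
  `|x| <= x' -> `|y| <= y' -> `|x * y| <= x' * y'.
Proof. by move=> xx' yy'; rewrite normrM ler_pM. Qed.

(** * Convergence of the cardinal series *)

Section cardinal_series.
Context {R : realType}.
Implicit Types (t x b th : R) (N : nat).

Definition sinc_sum t N : R := symsum (fun n => sinc (t - n%:~R)) N.

(* The shift [b] is free, and may depend on [th]: suitable choices turn one real
   estimate into estimates of both components of the Fourier sum. *)
Definition cos_sum t b N th : R :=
  symsum (fun n => sinc (t - n%:~R) * cos (2 * (t - n%:~R) * th + b)) N.

Lemma cos_sum0 t b N : cos_sum t b N 0 = sinc_sum t N * cos b.
Proof.
rewrite /sinc_sum mulr_symsuml; apply: eq_symsum => n.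
by rewrite mulr0 add0r.
Qed.

(** Differentiating the n-th cosine cancels the denominator pi (t - n) of its [sinc]. As sin (pi (t
    - n)) = (-1)^n sin (pi t), what remains is the alternating sum of [symsum_altsign_sin]. *)
Lemma is_derive_cos_sum t b N th : cos th != 0 ->
  is_derive th 1 (cos_sum t b N)
    (- (2 * sin (pi * t) / pi) * (-1) ^+ N *
     (sin (2 * t * th + b) * cos (N.*2.+1%:R * th)) / cos th).
Proof.
move=> c0.
pose dF n : R := - (2 * sin (pi * t) / pi) *
  (altsign n * sin ((2 * t * th + b) - 2 * n%:~R * th)).
have -> : - (2 * sin (pi * t) / pi) * (-1) ^+ N *
     (sin (2 * t * th + b) * cos (N.*2.+1%:R * th)) / cos th = symsum dF N.
  rewrite -mulr_symsumr -[LHS]mulrA -mulrA; congr (_ * _).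
  apply: (mulfI c0); rewrite symsum_altsign_sin mulrCA.
  by rewrite [cos th * (_ / _)]mulrC divfK.
apply: is_derive1_symsum => n.
have := is_derive1Ml (sinc (t - n%:~R))
  (is_derive1_cos_affine (2 * (t - n%:~R)) b th).
congr is_derive; rewrite /dF.
have -> : 2 * t * th + b - 2 * n%:~R * th = 2 * (t - n%:~R) * th + b by ring.
have := sincE (t - n%:~R); rewrite mulrBr sinBpi_int.
have := pi_gt0 R; move: (pi : R) => p p0; set s := sin (p * t); set z := sin _.
move=> /esym e; rewrite !mulrA.
have -> : - (2 * s / p) * altsign n = - 2 * (altsign n * s) / p by ring.
rewrite e; field.
by rewrite gt_eqF.
Qed.

(** Integrating cos (q y) by parts gains a factor 1 / q. It leaves a boundary term with denominator
    cos th and an integrand of order 1 / cos^2, whose integral is a tangent; the factor cos th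
    bounds both. *)
Lemma cos_sum_bound t b N th : - (pi / 2) < th < pi / 2 ->
  cos th * `|cos_sum t b N th - sinc_sum t N * cos b|
    <= (2 * `|t| + 2) / N.*2.+1%:R.
Proof.
set q : R := N.*2.+1%:R.
have q0 : 0 < q by rewrite ltr0n.
pose K : R := 2 * sin (pi * t) / pi * (-1) ^+ N.
have K1 : `|K| <= 1.
  rewrite normrM normrX normrN1 expr1n mulr1 normrM normfV normrM.
  rewrite (ger0_norm (ltW (pi_gt0 R))) ler_pdivrMr ?pi_gt0// mul1r.
  have := @sin_max R (pi * t); have := pi_ge2 R; rewrite ger0_norm//.
  by lra.
(* [f] adds to the cosine sum the boundary term of the integration by parts. *)
pose f (y : R) := cos_sum t b N y +
  K / q * (sin (2 * t * y + b) * (sin (q * y + 0) * (cos y)^-1)).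
(* The Dirichlet kernel cancels in the derivative of [f], so that everything left carries 1 / q. The
   summand 0 in [f] only fits the shape of [is_derive1_sin_affine]. *)
pose df (y : R) := K / q * (sin (q * y) *
  (2 * t * cos (2 * t * y + b) / cos y +
   sin (2 * t * y + b) * sin y / cos y ^+ 2)).
pose M : R := (2 * `|t| + 1) / q.
have M0 : 0 <= M by rewrite divr_ge0 ?ltW// addr_ge0 ?mulr_ge0.
have cgt0 (y : R) : - (pi / 2) < y < pi / 2 -> 0 < cos y.
  exact: cos_gt0_pihalf.
have f' (y : R) : - (pi / 2) < y < pi / 2 -> is_derive y 1 f (df y).
  move=> /cgt0 cy; have cN : cos y != 0 by rewrite gt_eqF.
  have := is_derive1D (is_derive_cos_sum t b N cN) (is_derive1Ml (K / q)
    (is_derive1M (is_derive1_sin_affine (2 * t) b y)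
    (is_derive1M (is_derive1_sin_affine q 0 y)
      (is_deriveV cN (is_derive_cos y))))).
  congr is_derive; rewrite /df /K -/q !addr0 /GRing.scale/=.
  move: (pi_gt0 R) q0; move: (pi : R) (q) => p r p0 r0; field.
  by rewrite cN !gt_eqF.
have g' (y : R) : - (pi / 2) < y < pi / 2 ->
    is_derive y 1 (fun y => M * tan y) (M * (cos y) ^- 2).
  by move=> /cgt0 cy; apply/is_derive1Ml/is_derive_tan; rewrite gt_eqF.
have df_le (y : R) : - (pi / 2) < y < pi / 2 -> `|df y| <= M * (cos y) ^- 2.
  move=> /cgt0 cy.
  have -> : df y = (K / q * sin (q * y) *
      (2 * t * cos (2 * t * y + b) * cos y + sin (2 * t * y + b) * sin y)) *
      (cos y) ^- 2.
    by rewrite /df; field; rewrite !gt_eqF.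
  rewrite normrM (ger0_norm (_ : 0 <= _ ^- 2)); last first.
    by rewrite invr_ge0 exprn_ge0// ltW.
  apply: ler_wpM2r; first by rewrite invr_ge0 exprn_ge0// ltW.
  have -> : M = 1 / q * 1 * (2 * `|t| + 1) by rewrite /M; ring.
  apply: ler_normM; first apply: ler_normM.
  - rewrite normrM normfV (gtr0_norm q0).
    by rewrite ler_wpM2r// invr_ge0 ltW.
  - exact: sin_max.
  - apply: (le_trans (ler_normD _ _)); apply: lerD.
      rewrite -[leRHS]mulr1; apply: ler_normM; last exact: cos_max.
      rewrite -[leRHS]mulr1; apply: ler_normM; last exact: cos_max.
      by rewrite normrM ger0_norm.
    by rewrite -[leRHS]mulr1; apply: ler_normM; exact: sin_max.
move=> thI; have cth := cgt0 _ thI.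
have pi20 : 0 < pi / 2 :> R by rewrite divr_gt0 ?pi_gt0.
have fth : `|f th - f 0| <= `|M * tan th|.
  (* The comparison requires ordered endpoints, hence one case for each sign of [th]. *)
  have [th0|/ltW th0] := leP 0 th.
    have sub (y : R) : 0 <= y <= th -> - (pi / 2) < y < pi / 2 by lra.
    apply: le_trans (le_dist_is_derive (g := fun y => M * tan y) th0
      (fun y yI => f' y (sub y yI)) (fun y yI => g' y (sub y yI)) _) _.
      by move=> y /andP[y0 yth]; apply/df_le/sub; rewrite !ltW.
    by rewrite tan0 mulr0 subr0 ler_norm.
  have sub (y : R) : th <= y <= 0 -> - (pi / 2) < y < pi / 2 by lra.
  rewrite distrC.
  apply: le_trans (le_dist_is_derive (g := fun y => M * tan y) th0
    (fun y yI => f' y (sub y yI)) (fun y yI => g' y (sub y yI)) _) _.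
    by move=> y /andP[y0 yth]; apply/df_le/sub; rewrite !ltW.
  by rewrite tan0 mulr0 sub0r -normrN ler_norm.
have f0 : f 0 = sinc_sum t N * cos b.
  by rewrite /f cos_sum0 !mulr0 addr0 sin0 mul0r !mulr0 addr0.
rewrite -f0 -[X in X * `|_|](gtr0_norm cth) -normrM.
(* After multiplication by cos th, the majorant [M * tan th] becomes M sin th and the boundary term
   loses its denominator; they contribute [M] and 1 / q. *)
have -> : cos th * (cos_sum t b N th - f 0) = cos th * (f th - f 0) -
    K / q * (sin (2 * t * th + b) * sin (q * th + 0)).
  rewrite [f th]/f; move: (f 0) (K / q) => z k; field.
  by rewrite gt_eqF.
apply: (le_trans (ler_normB _ _)).
have -> : (2 * `|t| + 2) / q = M + 1 / q by rewrite /M; field; rewrite gt_eqF.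
apply: lerD.
  rewrite normrM (gtr0_norm cth); apply: le_trans (ler_wpM2l (ltW cth) fth) _.
  rewrite normrM (ger0_norm M0) mulrCA -[leRHS]mulr1 ler_wpM2l//.
  rewrite -[X in X * _](gtr0_norm cth) -normrM /tan mulrCA mulfV ?gt_eqF//.
  by rewrite mulr1 sin_max.
rewrite normrM -[leRHS]mulr1 ler_pM//.
  by rewrite normrM normfV (gtr0_norm q0) ler_wpM2r// invr_ge0 ltW.
by rewrite normrM mulr_ile1 ?sin_max.
Qed.

End cardinal_series.

(** * The limit of the sinc sums *)

Section sinc_sum_limit.
Context {R : realType}.
Implicit Types (t x a b th : R) (N : nat) (m n : int).

(** The primitive is sin (a y) / a for nonzero a and y for a = 0; [sinc] merges the two formulas. *)
Lemma is_derive_sinc_primitive a th :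
  is_derive th 1 (fun y => y * sinc (a * y / pi)) (cos (a * th)).
Proof.
have [->|a0] := eqVneq a 0.
  rewrite mul0r cos0; under eq_fun do rewrite !mul0r /sinc eqxx mulr1.
  exact: is_derive_id.
have -> : (fun y => y * sinc (a * y / pi)) = fun y => a^-1 * sin (a * y + 0).
  apply/funext => y; apply: (mulfI a0).
  rewrite mulrA mulVKf// addr0; have := sincE (a * y / pi).
  by rewrite mulrCA mulfV ?gt_eqF ?pi_gt0// mulr1.
have := is_derive1Ml a^-1 (is_derive1_sin_affine a 0 th).
by rewrite mulKf// addr0.
Qed.

(** By the product-to-sum formula, this is the integral from 0 to th of cos y cos ((2 x + 1) y). *)
Definition cos_cos_primitive x th : R :=
  2^-1 * (th * sinc (2 * x * th / pi) + th * sinc ((2 * x + 2) * th / pi)).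

Lemma is_derive_cos_cos_primitive x th :
  is_derive th 1 (cos_cos_primitive x) (cos th * cos ((2 * x + 1) * th)).
Proof.
have := is_derive1Ml 2^-1 (is_derive1D (is_derive_sinc_primitive (2 * x) th)
  (is_derive_sinc_primitive (2 * x + 2) th)).
congr is_derive.
have -> : 2 * x * th = (2 * x + 1) * th - th by ring.
have -> : (2 * x + 2) * th = (2 * x + 1) * th + th by ring.
rewrite cosB cosD; move: (cos _) (cos _) (sin _) (sin _) => c d s s'.
by field.
Qed.

Lemma cos_cos_primitive0 x : cos_cos_primitive x 0 = 0.
Proof. by rewrite /cos_cos_primitive !mul0r addr0 mulr0. Qed.

(** For integer x the value is pi / 4 at x = 0 and x = -1, and 0 elsewhere: the orthogonality
    relation that isolates two Fourier coefficients. *)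
Lemma cos_cos_primitive_pihalf x :
  cos_cos_primitive x (pi / 2) = pi / 4 * (sinc x + sinc (x + 1)).
Proof.
have p0 : (pi : R) != 0 by rewrite gt_eqF ?pi_gt0.
rewrite /cos_cos_primitive.
have -> : 2 * x * (pi / 2) / pi = x.
  by move: (pi : R) p0 => p p0; field.
have -> : (2 * x + 2) * (pi / 2) / pi = x + 1.
  by move: (pi : R) p0 => p p0; field.
by move: (sinc _) (sinc _) (pi : R) => s s' p; field.
Qed.

(* Tests the approximation of [cos_sum_bound] against the two Fourier modes
   [m] and [m - 1] on [0, pi / 2]. *)
Lemma sinc_sum_dist1 t m N : (`|m|.+1 <= N)%N ->
  `|1 - sinc_sum t N| * `|sinc (t - m%:~R) + sinc (t - m%:~R + 1)|
    <= 2 * (2 * `|t| + 2) / N.*2.+1%:R.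
Proof.
move=> mN; set c := sinc_sum t N; set K := (2 * `|t| + 2) / N.*2.+1%:R.
have K0 : 0 <= K by rewrite divr_ge0// addr_ge0 ?mulr_ge0.
(* [P] is the integral from 0 to th of cos y times the error estimated in [cos_sum_bound], tested
   against the chosen modes. *)
pose P (th : R) := symsum (fun n => sinc (t - n%:~R) *
    cos_cos_primitive (n%:~R - m%:~R) th) N +
  - c * cos_cos_primitive (t - m%:~R) th.
pose dP (th : R) := symsum (fun n => sinc (t - n%:~R) *
    (cos th * cos ((2 * (n%:~R - m%:~R) + 1) * th))) N +
  - c * (cos th * cos ((2 * (t - m%:~R) + 1) * th)).
have P' th : is_derive th 1 P (dP th).
  apply: is_derive1D; last exact/is_derive1Ml/is_derive_cos_cos_primitive.
  apply: is_derive1_symsum => n.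
  exact/is_derive1Ml/is_derive_cos_cos_primitive.
have dP_le th : 0 < th < pi / 2 -> `|dP th| <= K.
  move=> /andP[th0 th1].
  have thI : - (pi / 2) < th < pi / 2.
    by rewrite th1 andbT (lt_trans _ th0)// oppr_lt0 (lt_trans th0).
  (* This shift, which depends on [th], turns the phase 2 (t - n) th into -(2 (n - m) + 1) th. *)
  have := cos_sum_bound t (- ((2 * (t - m%:~R) + 1) * th)) N thI.
  apply: le_trans.
  rewrite -[X in X * _]ger0_norm; last exact/ltW/cos_gt0_pihalf.
  rewrite -normrM le_eqVlt; apply/orP; left; apply/eqP; congr `|_|.
  rewrite cosN mulrBr /dP mulNr mulrCA; congr (_ - _).
  rewrite mulr_symsumr; apply: eq_symsum => n.
  rewrite mulrCA; congr (_ * (_ * _)); rewrite -cosN; congr cos.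
  by ring.
have PE : P (pi / 2) = pi / 4 * ((1 - c) *
    (sinc (t - m%:~R) + sinc (t - m%:~R + 1))).
  rewrite /P cos_cos_primitive_pihalf.
  rewrite (@eq_symsum _ _ (fun n => pi / 4 *
      (sinc (t - n%:~R) * (n == m)%:R + sinc (t - n%:~R) * (n == m - 1)%:R))).
    (* Both m and m - 1 must lie between -N and N, which is why [mN] bounds the successor of |m|. *)
    rewrite -mulr_symsumr symsumD !symsum_delta; [|lia..].
    rewrite intrB opprB [in t + (_ - _)]addrCA [1%:~R + _]addrC.
    by move: (sinc _) (sinc _) => ? ?; ring.
  move=> n; rewrite cos_cos_primitive_pihalf sinc_int.
  have -> : n%:~R - m%:~R + 1 = n%:~R - (m - 1)%:~R :> R by rewrite intrB; ring.
  by rewrite sinc_int [m == n]eq_sym [m - 1 == n]eq_sym; ring.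
have P0 : P 0 = 0.
  rewrite /P cos_cos_primitive0 mulr0 addr0 (@eq_symsum _ _ (fun n => 0 * 0)).
    by rewrite -mulr_symsuml mulr0.
  by move=> n; rewrite cos_cos_primitive0 mulr0 mul0r.
have pi2 : 0 <= pi / 2 :> R by rewrite divr_ge0 ?pi_ge0.
have := le_dist_is_derive pi2 (fun y _ => P' y)
  (fun y _ => is_derive1_affine K 0 y) dP_le.
rewrite P0 subr0 PE mulr0 !addr0 subr0 normrM [`|_ * (_ + _)|]normrM.
have := pi_gt0 R; move: (_ * `|_ + _|) => z p0.
rewrite ger0_norm ?divr_ge0 ?pi_ge0// => le_z.
(* The interval has length pi / 2; dividing by the coefficient pi / 4 produces the constant 2. *)
rewrite -[leRHS]mulrA -/K -(ler_pM2l (_ : 0 < pi / 4)) ?divr_gt0//.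
by apply: le_trans le_z _; rewrite le_eqVlt; apply/orP; left; apply/eqP; field.
Qed.

(** Since sin (pi (x + 1)) = - sin (pi x), for x > 0 the sum is sin (pi x) / (pi x (x + 1)). *)
Lemma sincD_gt0 x : 0 <= x < 1 -> 0 < sinc x + sinc (x + 1).
Proof.
move=> /andP[]; rewrite le_eqVlt => /predU1P[<- _|x0 x1].
  have -> : 0 + 1 = 1%:~R - 0%:~R :> R by rewrite subr0 add0r.
  by rewrite sinc_int addr0 /sinc eqxx.
rewrite /sinc (gt_eqF x0) (gt_eqF (addr_gt0 x0 ltr01)) mulrDr mulr1 sinDpi.
have p0 := pi_gt0 R.
have : 0 < sin (pi * x) by rewrite sin_gt0_pi// mulr_gt0//= gtr_pMr.
move: p0; move: (sin (pi * x)) => s; move: (pi : R) => p p0 s0.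
have -> : s / (p * x) + - s / (p * x + p) = s / (p * x * (x + 1)).
  by field; rewrite !gt_eqF// addr_gt0// ?mulr_gt0.
by rewrite divr_gt0// !mulr_gt0 ?addr_gt0.
Qed.

Lemma cvg_const_div_odd (K : R) : K / N.*2.+1%:R @[N --> \oo] --> 0.
Proof.
rewrite -(mulr0 K); apply: cvgMl_tmp.
apply: (@squeeze_cvgr _ _ _ _ (cst 0) harmonic); last 2 first.
- exact: cvg_cst.
- exact: cvg_harmonic.
apply: nearW => N; rewrite invr_ge0 ler0n/= lef_pV2 ?posrE ?ltr0n//.
by rewrite ler_nat; lia.
Qed.

Lemma cvg_sinc_sum t : sinc_sum t N @[N --> \oo] --> (1 : R).
Proof.
(* Taking the floor puts t - m in [0, 1[, so [s0] is positive; being independent of N, it can be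
   divided out. *)
pose m := Num.floor t; pose s0 := sinc (t - m%:~R) + sinc (t - m%:~R + 1).
have s0_gt0 : 0 < s0.
  apply: sincD_gt0; rewrite subr_ge0 ltrBlDl -(intrD _ m 1).
  exact: real_floor_itv (num_real t).
apply/cvgrPdist_le => e e0.
have /cvgrPdist_le/(_ (e * s0) (mulr_gt0 e0 s0_gt0)) :=
  cvg_const_div_odd (2 * (2 * `|t| + 2)).
apply: filterS2 (nbhs_infty_ge `|m|.+1) => N mN.
rewrite sub0r normrN => le_e.
have := sinc_sum_dist1 t mN; rewrite -/s0 (gtr0_norm s0_gt0) => le_s.
rewrite -(ler_pM2r s0_gt0); apply: le_trans le_s _.
exact: le_trans (ler_norm _) le_e.
Qed.

End sinc_sum_limit.

(** * The measure mu and Lebesgue measure *)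

Definition lorentzian {R : realType} (k w : R) : R := (1 + k * w ^+ 2)^-1.

Section lorentzian.
Context {R : realType}.
Local Notation lambda := (@lebesgue_measure R).
Variables (k : R) (k_gt0 : 0 < k).

Lemma lorentzianV_gt0 (w : R) : 0 < 1 + k * w ^+ 2.
Proof. by rewrite ltr_pwDl// mulr_ge0 ?sqr_ge0 ?ltW. Qed.

Lemma lorentzian_gt0 (w : R) : 0 < lorentzian k w.
Proof. by rewrite invr_gt0 lorentzianV_gt0. Qed.

Lemma measurable_lorentzian : measurable_fun setT (lorentzian k).
Proof.
apply: continuous_measurable_fun => w.
apply: cvgV; first by rewrite gt_eqF ?lorentzianV_gt0.
apply: cvgD; first exact: cvg_cst.
by apply: cvgM; [exact: cvg_cst|exact: exprn_continuous].
Qed.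

Lemma emeasurable_lorentzian : measurable_fun setT (EFin \o lorentzian k).
Proof. by apply/measurable_EFinP; exact: measurable_lorentzian. Qed.

Lemma integrable_oneDsqrV :
  lambda.-integrable setT (fun w => ((oneDsqr w)^-1)%:E).
Proof.
have mf : measurable_fun setT (fun w : R => ((oneDsqr w)^-1)%:E).
  apply/measurable_EFinP; apply: continuous_measurable_fun.
  exact: continuous_oneDsqrV.
apply/integrableP; split => //; apply/abse_integralP => //.
rewrite ge0_symfun_integralT/=.
- rewrite (_ : [set x | _] = `[0, +oo[%classic); last first.
    by apply/seteqP; split => x/=; rewrite in_itv/= andbT.
  by rewrite integral0y_oneDsqr -EFinM/= ltry.
- by move=> x; rewrite invr_ge0 (le_trans _ (oneDsqr_ge1 x)).
- exact: continuous_oneDsqrV.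
- by move=> x/=; rewrite /oneDsqr sqrrN.
Qed.

Lemma integrable_lorentzian :
  lambda.-integrable setT (EFin \o lorentzian k).
Proof.
(* The constant works for small and large [k] alike: (1 + 1/k)(1 + k w^2) expands to 1 + w^2 plus
   nonnegative terms. *)
have := integrableZl measurableT (1 + k^-1) integrable_oneDsqrV.
apply: le_integrable => //.
  exact: emeasurable_lorentzian.
move=> w _; rewrite /= lee_fin.
have o0 : 0 < oneDsqr w by rewrite (lt_le_trans _ (oneDsqr_ge1 w)).
have k1 : 0 < 1 + k^-1 by rewrite addr_gt0 ?invr_gt0.
rewrite !gtr0_norm ?lorentzian_gt0 ?mulr_gt0 ?invr_gt0//.
rewrite ler_pdivlMr// mulrC ler_pdivrMr ?lorentzianV_gt0// /oneDsqr.
have -> : (1 + k^-1) * (1 + k * w ^+ 2) =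
    (1 + w ^+ 2) + (k^-1 + k * w ^+ 2).
  by field; rewrite gt_eqF.
rewrite lerDl; apply: addr_ge0; first by rewrite invr_ge0 ltW.
by apply: mulr_ge0; rewrite ?sqr_ge0 ?ltW.
Qed.

(** Finiteness, with the domination below, gives access to the Radon-Nikodym theorem for [mu_]. *)
Lemma mu_fin_num : fin_num_fun (mu_ k_gt0).
Proof.
apply: lty_fin_num_fun.
have /integrableP[_] := integrable_lorentzian.
under eq_integral do rewrite /= (gtr0_norm (lorentzian_gt0 _)).
by [].
Qed.

HB.instance Definition _ :=
  Measure_isFinite.Build _ _ _ (mu_ k_gt0) mu_fin_num.

Lemma mu_dominates : mu_ k_gt0 `<< lambda.
Proof.
apply/null_content_dominatesP => A mA A0; apply: null_set_integral => //.
apply: measurable_funTS; exact: emeasurable_lorentzian.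
Qed.

(** The Radon-Nikodym derivative of [mu_] has the same integrals as the Lorentzian density, hence
    equals it almost everywhere; the change of variables formula then transfers integrability. *)
Lemma integrable_mu (f : R -> R) : (forall w, 0 <= f w) ->
  (mu_ k_gt0).-integrable setT (EFin \o f) ->
  lambda.-integrable setT (fun w => (lorentzian k w * f w)%:E).
Proof.
move=> f0 /integrableP[mf foo].
have mfr : measurable_fun setT f by exact/measurable_EFinP.
apply/integrableP; split.
  apply/measurable_EFinP; apply: measurable_funM => //.
  exact: measurable_lorentzian.
pose g := Radon_Nikodym_SigmaFinite.f (mu_ k_gt0) lambda.
have gE : ae_eq lambda setT g (EFin \o lorentzian k).
  apply: integral_ae_eq => //.
  - exact: Radon_Nikodym_SigmaFinite.f_integrable mu_dominates.
  - exact: emeasurable_lorentzian.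
  - move=> E _ mE.
    by rewrite -Radon_Nikodym_SigmaFinite.f_integral//; exact: mu_dominates.
have := Radon_Nikodym_SigmaFinite.change_of_variables mu_dominates
  (f := EFin \o f) (E := setT) _ measurableT mf.
rewrite -/g => fgE; move: foo.
under eq_integral do rewrite /= ger0_norm//.
rewrite -fgE/=; last by move=> w; rewrite lee_fin.
under [in X in _ -> X]eq_integral => w _.
  rewrite /= ger0_norm; last by rewrite mulr_ge0// ltW ?lorentzian_gt0.
  rewrite mulrC EFinM.
  over.
suff -> : (\int[lambda]_w ((f w)%:E * g w) =
    \int[lambda]_w ((f w)%:E * (lorentzian k w)%:E))%E by [].
apply: ae_eq_integral => //.
- apply: emeasurable_funM => //.
  exact: measurable_int (Radon_Nikodym_SigmaFinite.f_integrable mu_dominates).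
- by apply: emeasurable_funM => //; exact: emeasurable_lorentzian.
- exact: ae_eqe_mul2l.
Qed.

End lorentzian.

(** * Complex-valued integrals *)

Section Cintegral.
Context d (T : measurableType d) (R : realType).
Variable mu : {measure set T -> \bar R}.
Implicit Types (f g : T -> R[i]) (h : T -> R).

Definition Cintegrable f :=
  mu.-integrable setT (fun x => (complex.Re (f x))%:E) /\
  mu.-integrable setT (fun x => (complex.Im (f x))%:E).

Lemma CintegrableD f g : Cintegrable f -> Cintegrable g ->
  Cintegrable (fun x => f x + g x).
Proof.
move=> [rf jf] [rg jg]; split.
  apply: eq_integrable (integrableD measurableT rf rg) => // x _.
  by rewrite raddfD.
apply: eq_integrable (integrableD measurableT jf jg) => // x _.
by rewrite raddfD.
Qed.

Lemma CintegralD f g : Cintegrable f -> Cintegrable g ->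
  Cintegral mu (fun x => f x + g x) = Cintegral mu f + Cintegral mu g.
Proof.
move=> [rf jf] [rg jg]; rewrite /Cintegral.
under eq_Rintegral do rewrite raddfD/=.
under [X in _ +i* X]eq_Rintegral do rewrite raddfD/=.
by rewrite !RintegralD.
Qed.

Lemma CintegrableZr (c : R) f : Cintegrable f ->
  Cintegrable (fun x => f x * c%:C).
Proof.
move=> [rf jf]; split.
  apply: eq_integrable (integrableZr measurableT c rf) => // x _.
  by case: (f x) => a b /=; rewrite mulr0 subr0.
apply: eq_integrable (integrableZr measurableT c jf) => // x _.
by case: (f x) => a b /=; rewrite mulr0 add0r.
Qed.

Lemma CintegralZr (c : R) f : Cintegrable f ->
  Cintegral mu (fun x => f x * c%:C) = Cintegral mu f * c%:C.
Proof.
move=> [rf jf]; rewrite /Cintegral; simpc; rewrite -!RintegralZr//.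
by congr (_ +i* _); apply: eq_Rintegral => x _; case: (f x) => a b; simpc.
Qed.

Lemma Cintegrable_symsum (F : int -> T -> R[i]) N :
  (forall n, Cintegrable (F n)) -> Cintegrable (fun x => symsum (F^~ x) N).
Proof.
move=> FI; elim: N => [|N IH]; first by under eq_fun do rewrite symsum0.
under eq_fun do rewrite symsumS.
by apply: CintegrableD => //; apply: CintegrableD.
Qed.

Lemma Cintegral_symsum (F : int -> T -> R[i]) N :
  (forall n, Cintegrable (F n)) ->
  Cintegral mu (fun x => symsum (F^~ x) N) =
  symsum (fun n => Cintegral mu (F n)) N.
Proof.
move=> FI; elim: N => [|N IH].
  by rewrite symsum0; under eq_fun do rewrite symsum0.
under eq_fun do rewrite symsumS.
rewrite symsumS CintegralD ?CintegralD ?IH//.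
  exact: Cintegrable_symsum.
exact: CintegrableD.
Qed.

Lemma normc_le_ReIm (z : R[i]) : `|z| <= (`|complex.Re z| + `|complex.Im z|)%:C.
Proof.
rewrite normc_def lecR -[leRHS]ger0_norm ?addr_ge0// -sqrtr_sqr ler_wsqrtr//.
by rewrite sqrrD !real_normK ?num_real// addrAC lerDl mulrn_wge0 ?mulr_ge0.
Qed.

(** The factor 2 comes from bounding the two components separately. *)
Lemma le_norm_Cintegral f h : Cintegrable f ->
  mu.-integrable setT (EFin \o h) ->
  (forall x, `|complex.Re (f x)| <= h x) ->
  (forall x, `|complex.Im (f x)| <= h x) ->
  `|Cintegral mu f| <= (2 * \int[mu]_x h x)%:C.
Proof.
move=> [rf jf] ih rh jh; apply: le_trans (normc_le_ReIm _) _.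
rewrite lecR /= mulr2n mulrDl mul1r; apply: lerD.
  apply: le_trans (le_normr_Rintegral measurableT rf) _.
  apply: le_Rintegral => //; exact: integrable_norm.
apply: le_trans (le_normr_Rintegral measurableT jf) _.
by apply: le_Rintegral => //; exact: integrable_norm.
Qed.

End Cintegral.

(** * The time representations *)

Section amplitude.
Context {R : realType}.
Local Notation lambda := (@lebesgue_measure R).
Variables (k : R) (k_gt0 : 0 < k) (psi : R -> R[i]).
Hypothesis psiL2 : L2 (mu_ k_gt0) psi.

Let theta (w : R) := atan (Num.sqrt k * w).

Let theta_itv w : - (pi / 2) < theta w < pi / 2.
Proof. by rewrite /theta atan_gtNpi2 atan_ltpi2. Qed.

Let cos_theta_gt0 w : 0 < cos (theta w).
Proof. exact: cos_gt0_pihalf. Qed.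

Definition weight (w : R) : R := ((1 + k * w ^+ 2) `^ (3 / 2))^-1.

(** The exponent splits as 1 + 1/2, and cos (atan x) = 1 / sqrt (1 + x^2) absorbs the half power. *)
Lemma weightE w : weight w = lorentzian k w * cos (atan (Num.sqrt k * w)).
Proof.
rewrite /weight /lorentzian cos_atan exprMn sqr_sqrtr ?ltW// -invfM.
have := lorentzianV_gt0 k_gt0 w; move: (1 + _) => x x0.
have -> : 3 / 2 = 1 + 2^-1 :> R by field.
rewrite powRD; last by apply/implyP => _; rewrite gt_eqF.
by rewrite powRr1 ?ltW// powR12_sqrt ?ltW.
Qed.

(** An integrable majorant, quadratic in psi: the measure is finite and psi is square integrable. *)
Definition envelope (w : R) : R :=
  lorentzian k w *
  (1 + complex.Re (psi w) ^+ 2 + complex.Im (psi w) ^+ 2).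

Lemma envelope_ge0 w : 0 <= envelope w.
Proof.
by rewrite mulr_ge0 ?(ltW (lorentzian_gt0 k_gt0 w))// !addr_ge0 ?sqr_ge0.
Qed.

Lemma integrable_envelope : lambda.-integrable setT (EFin \o envelope).
Proof.
have [_ _ ipsi] := psiL2.
have := integrable_mu (fun w => sqr_ge0 (Normc.normc (psi w))) ipsi.
move=> /(integrableD measurableT (integrable_lorentzian k_gt0)).
apply: eq_integrable => // w _; rewrite /= /envelope -EFinD; congr EFin.
case: (psi w) => a b /=; rewrite sqr_sqrtr ?addr_ge0 ?sqr_ge0//.
by ring.
Qed.

Definition amplitude (phi : R -> R[i]) (w : R) : R[i] :=
  (weight w)%:C * phi w * psi w.

(** The cosine contained in the weight is spent on [phi], which may therefore be controlled only up
    to a factor 1 / cos theta. *)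
Lemma amplitude_le (B : R) (phi : R -> R[i]) (w : R) :
  cos (theta w) * `|complex.Re (phi w)| <= B ->
  cos (theta w) * `|complex.Im (phi w)| <= B ->
  `|complex.Re (amplitude phi w)| <= B * envelope w /\
  `|complex.Im (amplitude phi w)| <= B * envelope w.
Proof.
rewrite /amplitude /envelope weightE -/(theta w).
have := cos_theta_gt0 w; have := lorentzian_gt0 k_gt0 w.
move: (lorentzian k w) (cos (theta w)) => l c l0 c0.
case: (phi w) (psi w) => p q [a b] /= cp cq.
have B0 : 0 <= B by apply: le_trans cp; rewrite mulr_ge0// ltW.
rewrite !(mul0r, subr0, addr0).
have key (u v x y : R) : c * `|u| <= B -> c * `|v| <= B ->
    `|l * c * u * x + l * c * v * y| <= B * (l * (1 + x ^+ 2 + y ^+ 2)).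
  move=> cu cv; apply: le_trans (ler_normD _ _) _.
  rewrite !normrM (gtr0_norm l0) (gtr0_norm c0).
  (* It follows from |x| <= (1 + x^2) / 2 and the same for y. *)
  have xy : `|x| + `|y| <= 1 + x ^+ 2 + y ^+ 2.
    have := sqr_ge0 (`|x| - 1); have := sqr_ge0 (`|y| - 1).
    rewrite -[x ^+ 2]real_normK ?num_real// -[y ^+ 2]real_normK ?num_real//.
    have := normr_ge0 x; have := normr_ge0 y; nra.
  have -> : l * c * `|u| * `|x| + l * c * `|v| * `|y| =
     l * (c * `|u| * `|x| + c * `|v| * `|y|) by ring.
  rewrite mulrCA ler_pM2l//; apply: le_trans (ler_wpM2l B0 xy).
  by rewrite mulrDr lerD// ler_wpM2r.
split.
  by have := key p (- q) a b cp; rewrite normrN mulrN mulNr; apply.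
have := key p q b a cp cq.
by rewrite [1 + b ^+ 2 + _]addrAC.
Qed.

Lemma Cintegrable_amplitude (phi : R -> R[i]) :
  measurable_fun setT (fun w => complex.Re (phi w)) ->
  measurable_fun setT (fun w => complex.Im (phi w)) ->
  (forall w, `|complex.Re (phi w)| <= 1) ->
  (forall w, `|complex.Im (phi w)| <= 1) ->
  Cintegrable lambda (amplitude phi).
Proof.
move=> mr mj r1 j1; have [mpr mpj _] := psiL2.
have le1 w (x : R) : `|x| <= 1 -> cos (theta w) * `|x| <= 1.
  by move=> x1; rewrite mulr_ile1 ?cos_max ?(ltW (cos_theta_gt0 w)) ?cos_le1.
have mw : measurable_fun setT weight.
  rewrite (_ : weight = fun w => lorentzian k w * cos (theta w)).
    apply: measurable_funM; first exact: measurable_lorentzian.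
    apply: continuous_measurable_fun => w.
    apply: continuous_comp; last exact: continuous_cos.
    apply: continuous_comp; last exact: continuous_atan.
    by apply: cvgM; [exact: cvg_cst|exact: cvg_id].
  by apply/funext => w; rewrite weightE.
split; apply: le_integrable integrable_envelope => //.
- apply/measurable_EFinP.
  rewrite (_ : (fun w => _) = fun w => weight w * complex.Re (phi w) *
    complex.Re (psi w) - weight w * complex.Im (phi w) * complex.Im (psi w)).
    by apply: measurable_funB; apply: measurable_funM => //;
      apply: measurable_funM.
  apply/funext => w; rewrite /amplitude.
  by case: (phi w) (psi w) => p q [a b]; simpc.
- move=> w _; rewrite lee_fin/= [leRHS]ger0_norm ?envelope_ge0//.
  rewrite -[leRHS]mul1r.
  by have [] := amplitude_le (le1 w _ (r1 w)) (le1 w _ (j1 w)).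
- apply/measurable_EFinP.
  rewrite (_ : (fun w => _) = fun w => weight w * complex.Re (phi w) *
    complex.Im (psi w) + weight w * complex.Im (phi w) * complex.Re (psi w)).
    by apply: measurable_funD; apply: measurable_funM => //;
      apply: measurable_funM.
  apply/funext => w; rewrite /amplitude.
  by case: (phi w) (psi w) => p q [a b]; simpc.
- move=> w _; rewrite lee_fin/= [leRHS]ger0_norm ?envelope_ge0//.
  rewrite -[leRHS]mul1r.
  by have [] := amplitude_le (le1 w _ (r1 w)) (le1 w _ (j1 w)).
Qed.

Lemma Cintegrable_amplitude_expi (c : R) :
  Cintegrable lambda (amplitude (fun w => expi (c * theta w))).
Proof.
apply: Cintegrable_amplitude => [||w|w] /=.
- apply: continuous_measurable_fun => w.
  apply: continuous_comp; last exact: continuous_cos.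
  apply: cvgM; first exact: cvg_cst.
  apply: continuous_comp; last exact: continuous_atan.
  by apply: cvgM; [exact: cvg_cst|exact: cvg_id].
- apply: continuous_measurable_fun => w.
  apply: continuous_comp; last exact: continuous_sin.
  apply: cvgM; first exact: cvg_cst.
  apply: continuous_comp; last exact: continuous_atan.
  by apply: cvgM; [exact: cvg_cst|exact: cvg_id].
- exact: cos_max.
- exact: sin_max.
Qed.

(** * Truncation error of the cardinal series *)

Definition cardinal_error (l t : R) N (w : R) : R[i] :=
  symsum (fun n => expi (2 * (l + n%:~R) * theta w) * (sinc (t - n%:~R))%:C) N
  - expi (2 * (l + t) * theta w).

(** The first term comes from [cos_sum_bound], the second from replacing the sinc sum by its limit
    1. *)
Definition cardinal_error_bound (t : R) N : R :=
  (2 * `|t| + 2) / N.*2.+1%:R + `|1 - sinc_sum t N|.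

Lemma cvg_cardinal_error_bound t :
  cardinal_error_bound t N @[N --> \oo] --> (0 : R).
Proof.
rewrite -(addr0 (0 : R)); apply: cvgD; first exact: cvg_const_div_odd.
rewrite -(@normr0 _ R) -(subrr (1 : R)); apply: cvg_norm.
by apply: cvgB; [exact: cvg_cst|exact: cvg_sinc_sum].
Qed.

(** The shift [b] turns the phase 2 (t - n) th + b into a - 2 (l + n) th. Then a = 0 yields the real
    parts of the exponentials and a = pi / 2 the imaginary parts. *)
Lemma cos_shift_bound (l t a : R) N (w : R) :
  cos (theta w) * `|symsum (fun n => sinc (t - n%:~R) *
      cos (2 * (l + n%:~R) * theta w - a)) N - cos (2 * (l + t) * theta w - a)|
    <= cardinal_error_bound t N.
Proof.
set th := theta w; set b := a - 2 * (l + t) * th.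
have -> : symsum (fun n => sinc (t - n%:~R) *
    cos (2 * (l + n%:~R) * th - a)) N = cos_sum t b N th.
  apply: eq_symsum => n; congr (_ * _); rewrite -cosN; congr cos.
  by rewrite /b; ring.
have -> : cos (2 * (l + t) * th - a) = cos b by rewrite -cosN opprB.
have -> : cos_sum t b N th - cos b =
    (cos_sum t b N th - sinc_sum t N * cos b) - (1 - sinc_sum t N) * cos b.
  by ring.
apply: le_trans (ler_wpM2l (ltW (cos_theta_gt0 w)) (ler_normB _ _)) _.
rewrite mulrDr lerD// ?cos_sum_bound ?theta_itv//.
rewrite normrM mulrCA -[leRHS]mulr1 ler_wpM2l// -[X in X * _]gtr0_norm//.
by rewrite -normrM -[leRHS]mulr1 ler_normM ?cos_max.
Qed.

Lemma cardinal_error_le l t N w :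
  cos (theta w) * `|complex.Re (cardinal_error l t N w)|
    <= cardinal_error_bound t N /\
  cos (theta w) * `|complex.Im (cardinal_error l t N w)|
    <= cardinal_error_bound t N.
Proof.
rewrite /cardinal_error; split; rewrite raddfB symsum_raddf/=.
  have := cos_shift_bound l t 0 N w; rewrite subr0.
  congr (_ * `|_ - _| <= _); apply: eq_symsum => n /=.
  by rewrite subr0 mulr0 subr0 mulrC.
have := cos_shift_bound l t (pi / 2) N w; rewrite cosBpihalf.
congr (_ * `|_ - _| <= _); apply: eq_symsum => n /=.
by rewrite cosBpihalf mulr0 add0r mulrC.
Qed.

Lemma psidE l n : psid k l psi n = (Num.sqrt (2 * Num.sqrt k / pi))%:C *
  Cintegral lambda (amplitude (fun w => expi (2 * (l + n%:~R) * theta w))).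
Proof. by []. Qed.

Lemma psicE l t : psic k psi (2 * Num.sqrt k * (l + t)) =
  (Num.sqrt (2 * Num.sqrt k / pi))%:C *
  Cintegral lambda (amplitude (fun w => expi (2 * (l + t) * theta w))).
Proof.
rewrite /psic; congr (_ * Cintegral _ _); apply/funext => w.
congr (_ * expi _ * _); rewrite -/(theta w).
have : 0 < Num.sqrt k by rewrite sqrtr_gt0.
by move: (Num.sqrt k) => s s0; field; rewrite gt_eqF.
Qed.

Lemma amplitude_cardinal_error l t N :
  amplitude (cardinal_error l t N) = fun w =>
    symsum (fun n => amplitude (fun w => expi (2 * (l + n%:~R) * theta w)) w *
      (sinc (t - n%:~R))%:C) N +
    amplitude (fun w => expi (2 * (l + t) * theta w)) w * (-1)%:C.
Proof.
apply/funext => w; rewrite /amplitude /cardinal_error.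
rewrite mulrBr mulrBl mulr_symsumr mulr_symsuml rmorphN1 mulrN1.
by congr (_ - _); apply: eq_symsum => n; rewrite mulrA mulrAC.
Qed.

Lemma Cintegrable_amplitude_error l t N :
  Cintegrable lambda (amplitude (cardinal_error l t N)).
Proof.
rewrite amplitude_cardinal_error; apply: CintegrableD.
  apply: Cintegrable_symsum => n.
  exact/CintegrableZr/Cintegrable_amplitude_expi.
exact/CintegrableZr/Cintegrable_amplitude_expi.
Qed.

(** Linearity gathers the finite sum and its expected limit under one integral. *)
Lemma cardinal_series_sub (l t : R) N :
  psic k psi (2 * Num.sqrt k * (l + t)) -
  symsum (fun n => psid k l psi n * (sinc (t - n%:~R))%:C) N =
  - ((Num.sqrt (2 * Num.sqrt k / pi))%:C *
     Cintegral lambda (amplitude (cardinal_error l t N))).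
Proof.
have iE n := Cintegrable_amplitude_expi (2 * (l + n%:~R)).
have iF n := CintegrableZr (sinc (t - n%:~R)) (iE n).
have iG := CintegrableZr (-1) (Cintegrable_amplitude_expi (2 * (l + t))).
rewrite amplitude_cardinal_error.
rewrite CintegralD//; last exact: Cintegrable_symsum.
rewrite Cintegral_symsum// CintegralZr; last exact: Cintegrable_amplitude_expi.
rewrite psicE [in RHS]mulrDr mulr_symsumr rmorphN1 mulrN1 mulrN opprB.
congr (_ - _).
by apply: eq_symsum => n; rewrite psidE CintegralZr// mulrA.
Qed.

Lemma cvg_cardinal_series (l t : R) :
  symsum (fun n => psid k l psi n * (sinc (t - n%:~R))%:C) N @[N --> \oo]
    --> (psic k psi (2 * Num.sqrt k * (l + t)) : R[i]^o).
Proof.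
(* A positive complex number has zero imaginary part, so the tolerance is a real [e]. *)
apply/(@cvgrPdist_le _ R[i]^o) => -[e e'] /[1!ltcE] /andP[/eqP/= -> e0].
pose C := Num.sqrt (2 * Num.sqrt k / pi); pose J := \int[lambda]_w envelope w.
have : C * (2 * (cardinal_error_bound t N * J)) @[N --> \oo] --> (0 : R).
  rewrite -(mulr0 C); apply: cvgMl_tmp; rewrite -(mulr0 2); apply: cvgMl_tmp.
  rewrite -(mul0r J); apply: cvgMr_tmp; exact: cvg_cardinal_error_bound.
move=> /cvgrPdist_le/(_ e e0); apply: filterS => N.
rewrite sub0r normrN => le_e.
rewrite cardinal_series_sub normrN normrM normc_def/= expr0n addr0 sqrtr_sqr.
rewrite ger0_norm ?sqrtr_ge0// -/C.
have le_err := cardinal_error_le l t N.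
have iB : lambda.-integrable setT
    (fun w => (cardinal_error_bound t N * envelope w)%:E).
  exact: eq_integrable (integrableZl measurableT _ integrable_envelope).
have iA : Cintegrable lambda (amplitude (cardinal_error l t N)).
  exact: Cintegrable_amplitude_error.
(* The pointwise bound is a constant tending to 0 with N times the fixed integrable [envelope], so
   the integral tends to 0. *)
apply: (@le_trans _ _ (C%:C *
    (2 * \int[lambda]_w (cardinal_error_bound t N * envelope w))%:C)).
  apply: ler_wpM2l; first by rewrite ler0c sqrtr_ge0.
  by apply: le_norm_Cintegral => // w; have [le1 le2] := le_err w;
    have [] := amplitude_le le1 le2.
rewrite RintegralZl//; last exact: integrable_envelope.
rewrite -rmorphM lecR; exact: le_trans (ler_norm _) le_e.
Qed.

End amplitude.

Theorem mainTheorem1 (R : realType) (kappa lambda : R)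
    (kappa_gt0 : 0 < kappa) (lambda_ge0 : 0 <= lambda) (lambda_lt1 : lambda < 1)
    (psi : R -> R[i]) (psiL2 : L2 (mu_ kappa_gt0) psi) :
  (forall n : int,
     psid kappa lambda psi n
     = psic kappa psi (2 * Num.sqrt kappa * (lambda + n%:~R))) /\
  (forall tau : R,
     symsum (fun n : int => psid kappa lambda psi n *
       (sinc ((tau - 2 * Num.sqrt kappa * (lambda + n%:~R))
              / (2 * Num.sqrt kappa)))%:C) N @[N --> \oo]
     --> (psic kappa psi tau : R[i]^o)).
Proof.
split=> [n|tau]; first by rewrite psidE psicE.
have s0 : 2 * Num.sqrt kappa != 0 by rewrite mulf_neq0 ?gt_eqF ?sqrtr_gt0.
(* In this variable the sampling instants become the integers. *)
pose t := tau / (2 * Num.sqrt kappa) - lambda.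
have -> : tau = 2 * Num.sqrt kappa * (lambda + t).
  by rewrite /t addrC subrK mulrC divfK.
rewrite (_ : (fun n : int => _) =
    fun n => psid kappa lambda psi n * (sinc (t - n%:~R))%:C).
  exact: cvg_cardinal_series psiL2 _ _.
apply/funext => n; congr (_ * (sinc _)%:C).
by rewrite -mulrBr [LHS]mulrC mulKf// opprD addrACA subrr add0r.
Qed.
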